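(* Let $k$ be a commutative unital ring, and let $A$ be a (not necessarily associative, commutative or unital) $k$-algebra which is finitely presented as a $k$-module. Let $R \to R'$ be a faithfully flat and étale homomorphism of commutative unital associative $k$-algebras, with $k \to R$ flat. Put $R'' = R'\otimes_R R'$, let $u \in \mathbf{Aut}(A)(R'')$ be an $R'/R$-cocycle with values in $\mathbf{Aut}(A)$, and let $\mathcal{L}_u$ be the twisted form of $A_R = A\otimes_k R$ corresponding to $u$. Assume that the following two conditions hold. (i) The canonical map $\chi_{\mathcal{L}_u} : R \to \mathrm{Ctd}_k(\mathcal{L}_u)$, $r \mapsto \chi_r$ (where $\chi_r(x) = rx$), is an isomorphism. (ii) The cocycle $u$ belongs to the image of the natural group homomorphism $\mathbf{Aut}(A)(R''_0) \to \mathbf{Aut}(A)(R'')$. Then the Lie algebra homomorphism $$\eta_{\mathcal{L}_u} : \mathrm{Der}_k(\mathcal{L}_u) \to \mathrm{Der}_k(R)$$ admits a natural section $\rho : \mathrm{Der}_k(R) \to \mathrm{Der}_k(\mathcal{L}_u)$, namely the homomorphism of $k$-Lie algebras $\rho(d) = (\mathrm{id}_A \otimes d')|_{\mathcal{L}_u}$, where $d' \in \mathrm{Der}_k(R')$ is the unique derivation extending $d$ (in particular $\mathrm{id}_A\otimes d'$ stabilizes $\mathcal{L}_u$, and $\eta_{\mathcal{L}_u}\circ\rho = \mathrm{id}$). Furthermore, $$\mathrm{Der}_k(\mathcal{L}_u) = \mathrm{Der}_R(\mathcal{L}_u) \rtimes \rho\big(\mathrm{Der}_k(R)\big)$$ (that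 is, $\mathrm{Der}_R(\mathcal{L}_u)$ is an ideal of the $k$-Lie algebra $\mathrm{Der}_k(\mathcal{L}_u)$, $\rho(\mathrm{Der}_k(R))$ is a subalgebra, and $\mathrm{Der}_k(\mathcal{L}_u)$ is their direct sum as a $k$-module). In particular, if $k \to R$ is étale then $\mathrm{Der}_k(\mathcal{L}_u) = \mathrm{Der}_R(\mathcal{L}_u)$.
   Context: All rings $k, R, R',\dots$ are commutative and unital; ''algebra'' without further qualification (for $A$ and $\mathcal{L}_u$) means a module with a bilinear multiplication, not necessarily associative, commutative or unital. For an $S$-algebra $B$, $\mathrm{Der}_S(B)$ denotes the Lie algebra of $S$-linear derivations of $B$. Centroid: for an algebra $\mathcal{L}$ over a ring $S$, $\mathrm{Ctd}_S(\mathcal{L}) = \{\chi \in \mathrm{End}_S(\mathcal{L}) : \chi(xy) = \chi(x)y = x\chi(y)\ \text{for all } x,y\in \mathcal{L}\}$. If $\mathcal{L}$ is an $R$-algebra and $R$ is a $k$-algebra, $\mathcal{L}$ is also viewed as a $k$-algebra by restriction of scalars, and $\mathrm{Ctd}_R(\mathcal{L}) \subset \mathrm{Ctd}_k(\mathcal{L})$. The map $\eta$: suppose $\mathcal{L}$ is an $R$-algebra for which $\chi_{\mathcal{L}} : R \to \mathrm{Ctd}_k(\mathcal{L})$, $r\mapsto \chi_r$, is an isomorphism. For $\delta \in \mathrm{Der}_k(\mathcal{L})$ and $\chi \in \mathrm{Ctd}_k(\mathcal{L})$ the commutator $[\delta,\chi] = \delta\circ\chi - \chi\circ\delta$ lies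 in $\mathrm{Ctd}_k(\mathcal{L})$, and $\chi \mapsto [\delta,\chi]$ is a derivation of $\mathrm{Ctd}_k(\mathcal{L})$. Transporting via $\chi_{\mathcal{L}}$ gives the $k$-Lie algebra homomorphism $\eta_{\mathcal{L}} : \mathrm{Der}_k(\mathcal{L}) \to \mathrm{Der}_k(R)$, determined by $[\delta,\chi_r] = \chi_{\eta_{\mathcal{L}}(\delta)(r)}$ for all $r\in R$. Automorphism functor: $\mathbf{Aut}(A)(S)$ is the group of $S$-algebra automorphisms of $A_S = A\otimes_k S$, for every commutative $k$-algebra $S$; it is functorial in $S$ by base change. Cocycles and twisted forms: let $R'' = R'\otimes_R R'$ and $R''' = R'\otimes_R R'\otimes_R R'$. Let $p_1, p_2 : R' \to R''$ be $p_1(s) = s\otimes 1$, $p_2(s) = 1\otimes s$, and let $p_{12}, p_{13}, p_{23} : R''\to R'''$ be $p_{12}(a\otimes b) = a\otimes b\otimes 1$, $p_{13}(a\otimes b) = a\otimes 1\otimes b$, $p_{23}(a\otimes b) = 1\otimes a\otimes b$. The same symbols denote the induced group homomorphisms on $\mathbf{Aut}(A)$. An $R'/R$-cocycle with values in $\mathbf{Aut}(A)$ is an element $u\in\mathbf{Aut}(A)(R'')$ with $p_{13}(u) = p_{23}(u)\,p_{12}(u)$. The corresponding twisted form of $A_R$ is the $R$-algebra $$\mathcal{L}_u = \{x\in A\otimes_k R' : u\,p_1^A(x) = p_2^A(x)\},\qquad p_i^A = \mathrm{id}_A\otimes p_i : A\otimes_k R' \to A\otimes_k R''.$$ Extending derivations: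 since $R\to R'$ is faithfully flat, $R$ is identified with a $k$-subalgebra of $R'$. Since $R\to R'$ and $R\to R''$ are étale, every $d\in\mathrm{Der}_k(R)$ extends uniquely to a derivation $d'\in\mathrm{Der}_k(R')$ and uniquely to a derivation $d''\in\mathrm{Der}_k(R'')$. Define the $k$-subalgebra $R''_0 = \{s\in R'' : d''(s) = 0 \text{ for all } d\in\mathrm{Der}_k(R)\}$ of $R''$. The inclusion $R''_0\subset R''$ induces the group homomorphism $\mathbf{Aut}(A)(R''_0)\to\mathbf{Aut}(A)(R'')$ used in (ii). *)

(* Defs.v *)
From HB Require Import structures.
From mathcomp Require Import all_boot all_algebra.
From mathcomp Require Import boolp classical_sets functions.

Set Implicit Arguments.
Unset Strict Implicit.
Unset Printing Implicit Defensive.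

Import GRing.Theory.
Local Open Scope ring_scope.
Local Open Scope quotient_scope.

(* All rings are [comPzRingType]s, so that the zero ring is allowed.          *)

Section Linearity.
Variable k : comPzRingType.

Definition bilin (M N P : lmodType k) (f : M -> N -> P) : Prop :=
  (forall x, linear (f x)) /\ (forall y, linear (f^~ y)).

Definition exact (M N P : lmodType k) (f : M -> N) (g : N -> P) : Prop :=
  forall y, g y = 0 <-> exists x, f x = y.

Definition fin_pres_mod (M : lmodType k) : Prop :=
  exists (m n : nat) (f : {linear 'rV[k]_m -> 'rV[k]_n})
    (g : {linear 'rV[k]_n -> M}),
    exact f g /\ forall y, exists x, g x = y.

End Linearity.

Definition res (R S : comPzRingType) (f : {rmorphism R -> S})
  (M : lmodType S) : Type := M.

Section RestrictionOfScalars.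
Variables (R S : comPzRingType) (f : {rmorphism R -> S}) (M : lmodType S).

HB.instance Definition _ := GRing.Zmodule.on (res f M).

Definition res_scale (r : R) (x : res f M) : res f M := f r *: (x : M).

Fact res_scaleA a b x : res_scale a (res_scale b x) = res_scale (a * b) x.
Proof. by rewrite /res_scale scalerA rmorphM. Qed.
Fact res_scale1 : left_id 1 res_scale.
Proof. by move=> x; rewrite /res_scale rmorph1 scale1r. Qed.
Fact res_scaleDr : right_distributive res_scale +%R.
Proof. by move=> a x y; rewrite /res_scale; apply: scalerDr. Qed.
Fact res_scaleDl x : {morph res_scale^~ x : a b / a + b}.
Proof. by move=> a b; rewrite /res_scale rmorphD; apply: scalerDl. Qed.

HB.instance Definition _ := GRing.Zmodule_isLmodule.Build R (res f M)
  res_scaleA res_scale1 res_scaleDr res_scaleDl.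

Lemma res_scaleE r (x : res f M) : r *: x = (f r *: (x : M) : M).
Proof. by []. Qed.

End RestrictionOfScalars.

(* The tensor product of two modules: formal finite sums of pairs, modulo the *)
(* congruence generated by the bilinearity relations.                         *)
Section Tensor.
Variables (k : comPzRingType) (M N : lmodType k).

Inductive tens_eq : seq (M * N) -> seq (M * N) -> Prop :=
| tens_eq_refl s : tens_eq s s
| tens_eq_sym s t : tens_eq s t -> tens_eq t s
| tens_eq_trans t s u : tens_eq s t -> tens_eq t u -> tens_eq s u
| tens_eq_cat s s' t t' :
    tens_eq s s' -> tens_eq t t' -> tens_eq (s ++ t) (s' ++ t')
| tens_eq_comm s t : tens_eq (s ++ t) (t ++ s)
| tens_eq_0 y : tens_eq [:: (0, y)] [::]
| tens_eq_Dl x x' y : tens_eq [:: (x + x', y)] [:: (x, y); (x', y)]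
| tens_eq_Dr x y y' : tens_eq [:: (x, y + y')] [:: (x, y); (x, y')]
| tens_eq_Z a x y : tens_eq [:: (a *: x, y)] [:: (x, a *: y)].

Definition tens_eqb s t := `[< tens_eq s t >].

Fact tens_eqb_refl : reflexive tens_eqb.
Proof. by move=> s; apply/asboolP; apply: tens_eq_refl. Qed.
Fact tens_eqb_sym : symmetric tens_eqb.
Proof.
move=> s t; apply/idP/idP => /asboolP h; apply/asboolP;
  exact: tens_eq_sym.
Qed.
Fact tens_eqb_trans : transitive tens_eqb.
Proof.
move=> t s u /asboolP h1 /asboolP h2; apply/asboolP.
exact: tens_eq_trans h1 h2.
Qed.

Canonical tens_equiv :=
  EquivRel tens_eqb tens_eqb_refl tens_eqb_sym tens_eqb_trans.

Definition tens : Type := {eq_quot tens_equiv}.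
HB.instance Definition _ := Choice.on tens.

Definition tclass (s : seq (M * N)) : tens := \pi_({eq_quot tens_equiv}) s.
Definition trepr (q : tens) : seq (M * N) :=
  repr (q : {eq_quot tens_equiv}).
Definition tpure (x : M) (y : N) : tens := tclass [:: (x, y)].

Lemma treprK q : tclass (trepr q) = q.
Proof. exact: reprK. Qed.

Lemma tclassP s t : tclass s = tclass t <-> tens_eq s t.
Proof.
split=> [h|h]; first by apply/asboolP; apply/(@eqmodP _ tens_equiv).
by apply/(@eqmodP _ tens_equiv); apply/asboolP.
Qed.

Lemma treprP s : tens_eq (trepr (tclass s)) s.
Proof. by apply/tclassP; rewrite treprK. Qed.

Definition tzero : tens := tclass [::].
Definition tadd (q r : tens) : tens := tclass (trepr q ++ trepr r).
Definition topp (q : tens) : tens :=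
  tclass [seq (- p.1, p.2) | p <- trepr q].
Definition tscale (a : k) (q : tens) : tens :=
  tclass [seq (a *: p.1, p.2) | p <- trepr q].

Lemma taddE s t : tadd (tclass s) (tclass t) = tclass (s ++ t).
Proof. by apply/tclassP; apply: tens_eq_cat; apply: treprP. Qed.

Lemma tens_eq_map (g : M -> M) s t :
  {morph g : x y / x + y} -> scalable g -> tens_eq s t ->
  tens_eq [seq (g p.1, p.2) | p <- s] [seq (g p.1, p.2) | p <- t].
Proof.
move=> gD gZ; elim=> {s t} /=.
- by move=> s; apply: tens_eq_refl.
- by move=> s t _; apply: tens_eq_sym.
- by move=> t s u _ h1 _ h2; apply: tens_eq_trans h1 h2.
- by move=> s s' t t' _ h1 _ h2; rewrite !map_cat; apply: tens_eq_cat.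
- by move=> s t; rewrite !map_cat; apply: tens_eq_comm.
- move=> y; suff -> : g 0 = 0 by apply: tens_eq_0.
  by rewrite -[in LHS](scale0r 0) gZ scale0r.
- by move=> x x' y; rewrite gD; apply: tens_eq_Dl.
- by move=> x y y'; apply: tens_eq_Dr.
- by move=> a x y; rewrite gZ; apply: tens_eq_Z.
Qed.

Lemma toppE s : topp (tclass s) = tclass [seq (- p.1, p.2) | p <- s].
Proof.
apply/tclassP; apply: tens_eq_map (treprP s) => [x y|a x].
  exact: opprD.
by rewrite scalerN.
Qed.

Lemma tscaleE a s :
  tscale a (tclass s) = tclass [seq (a *: p.1, p.2) | p <- s].
Proof.
apply/tclassP; apply: tens_eq_map (treprP s) => [x y|b x].
  exact: scalerDr.
by rewrite !scalerA mulrC.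
Qed.

Lemma tclass_cons x y s : tclass ((x, y) :: s) = tadd (tpure x y) (tclass s).
Proof. by rewrite taddE. Qed.

Fact taddA : associative tadd.
Proof.
move=> q r s; rewrite -(treprK q) -(treprK r) -(treprK s) !taddE.
by rewrite catA.
Qed.
Fact taddC : commutative tadd.
Proof.
move=> q r; rewrite -(treprK q) -(treprK r) !taddE.
by apply/tclassP; apply: tens_eq_comm.
Qed.
Fact tadd0 : left_id tzero tadd.
Proof. by move=> q; rewrite -(treprK q) taddE. Qed.
Fact taddN : left_inverse tzero topp tadd.
Proof.
move=> q; rewrite -(treprK q); elim: (trepr q) => [|[x y] s IH].
  by rewrite toppE taddE.
rewrite toppE /= !tclass_cons -toppE.
rewrite taddA [tadd _ (tpure x y)]taddC taddA.
have -> : tadd (tpure x y) (tpure (- x) y) = tzero.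
  rewrite taddE; apply/tclassP; apply: tens_eq_trans (tens_eq_0 y).
  by apply: tens_eq_sym; rewrite -{1}(subrr x); apply: tens_eq_Dl.
by rewrite tadd0.
Qed.

HB.instance Definition _ :=
  GRing.isZmodule.Build tens taddA taddC tadd0 taddN.

Lemma tclassD s t : tclass s + tclass t = tclass (s ++ t).
Proof. exact: taddE. Qed.

Fact tscaleA a b q : tscale a (tscale b q) = tscale (a * b) q.
Proof.
rewrite -(treprK q) !tscaleE -map_comp; congr tclass.
by apply: eq_map => p /=; rewrite scalerA.
Qed.
Fact tscale1 : left_id 1 tscale.
Proof.
move=> q; rewrite -(treprK q) tscaleE; congr tclass.
by rewrite -[RHS]map_id; apply: eq_map => -[x y] /=; rewrite scale1r.
Qed.
Fact tscaleDr : right_distributive tscale +%R.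
Proof.
move=> a q r; rewrite -(treprK q) -(treprK r) tclassD !tscaleE tclassD.
by rewrite map_cat.
Qed.
Lemma tpureDl x x' y : tpure (x + x') y = tpure x y + tpure x' y.
Proof. by rewrite tclassD; apply/tclassP; apply: tens_eq_Dl. Qed.
Lemma tpureDr x y y' : tpure x (y + y') = tpure x y + tpure x y'.
Proof. by rewrite tclassD; apply/tclassP; apply: tens_eq_Dr. Qed.
Fact tscaleDl q : {morph tscale^~ q : a b / a + b}.
Proof.
move=> a b; rewrite -(treprK q) /=; elim: (trepr q) => [|[x y] s IH].
  by rewrite !tscaleE /= tclassD.
move: IH; rewrite !tscaleE /= !tclass_cons => ->.
by rewrite scalerDl tpureDl; apply: addrACA.
Qed.

HB.instance Definition _ := GRing.Zmodule_isLmodule.Build k tens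
  tscaleA tscale1 tscaleDr tscaleDl.

Lemma tpureZl a x y : tpure (a *: x) y = a *: tpure x y.
Proof. by rewrite /GRing.scale /= tscaleE. Qed.
Lemma tpureZr a x y : tpure x (a *: y) = a *: tpure x y.
Proof.
rewrite -tpureZl; apply/tclassP; apply: tens_eq_sym; exact: tens_eq_Z.
Qed.

Lemma tpure_bilin : bilin tpure.
Proof.
split=> [x a y y'|y a x x']; first by rewrite tpureDr tpureZr.
by rewrite tpureDl tpureZl.
Qed.

Lemma tclass_sum s : tclass s = \sum_(p <- s) tpure p.1 p.2.
Proof.
elim: s => [|[x y] s IH]; first by rewrite big_nil.
by rewrite big_cons -IH tclass_cons.
Qed.

Lemma tens_ind (P : tens -> Prop) :
  (forall x y, P (tpure x y)) -> (forall q r, P q -> P r -> P (q + r)) ->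
  P 0 -> forall q, P q.
Proof.
move=> Pp PD P0 q; rewrite -(treprK q) tclass_sum.
by elim/big_ind: _ => // p _.
Qed.

Section Lift.
Variables (P : lmodType k) (f : M -> N -> P) (bf : bilin f).

(* The linear map induced by a bilinear one.                                  *)
Definition tlift of bilin f := fun q : tens => \sum_(p <- trepr q) f p.1 p.2.

Lemma bilinDl x x' y : f (x + x') y = f x y + f x' y.
Proof. by have := bf.2 y 1 x x'; rewrite !scale1r. Qed.
Lemma bilinDr x y y' : f x (y + y') = f x y + f x y'.
Proof. by have := bf.1 x 1 y y'; rewrite !scale1r. Qed.
Lemma bilin0l y : f 0 y = 0.
Proof. by apply: (addrI (f 0 y)); rewrite -bilinDl !addr0. Qed.
Lemma bilin0r x : f x 0 = 0.
Proof. by apply: (addrI (f x 0)); rewrite -bilinDr !addr0. Qed.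
Lemma bilinZl a x y : f (a *: x) y = a *: f x y.
Proof. by have := bf.2 y a x 0; rewrite /= bilin0l !addr0. Qed.
Lemma bilinZr a x y : f x (a *: y) = a *: f x y.
Proof. by have := bf.1 x a y 0; rewrite /= bilin0r !addr0. Qed.

Lemma tens_eq_sum s t : tens_eq s t ->
  \sum_(p <- s) f p.1 p.2 = \sum_(p <- t) f p.1 p.2.
Proof.
elim=> {s t} //.
- by move=> t s u _ -> _ ->.
- by move=> s s' t t' _ h1 _ h2; rewrite !big_cat /= h1 h2.
- by move=> s t; rewrite !big_cat /= addrC.
- by move=> y; rewrite big_seq1 big_nil bilin0l.
- by move=> x x' y; rewrite big_seq1 big_cons big_seq1 bilinDl.
- by move=> x y y'; rewrite big_seq1 big_cons big_seq1 bilinDr.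
- by move=> a x y; rewrite !big_seq1 /= bilinZl bilinZr.
Qed.

Lemma tlift_class s : tlift bf (tclass s) = \sum_(p <- s) f p.1 p.2.
Proof. exact: tens_eq_sum (treprP s). Qed.

Lemma tliftE x y : tlift bf (tpure x y) = f x y.
Proof. by rewrite tlift_class big_seq1. Qed.

Fact tlift_linear : linear (tlift bf).
Proof.
move=> a q r; rewrite -(treprK q) -(treprK r).
rewrite {1}/GRing.scale /= tscaleE tclassD !tlift_class.
rewrite big_cat big_map scaler_sumr; congr (_ + _).
by apply: eq_bigr => p _; rewrite bilinZl.
Qed.

HB.instance Definition _ :=
  GRing.isLinear.Build k tens P *:%R (tlift bf) tlift_linear.

Lemma tliftD q r : tlift bf (q + r) = tlift bf q + tlift bf r.
Proof. exact: linearD. Qed.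
Lemma tliftB q r : tlift bf (q - r) = tlift bf q - tlift bf r.
Proof. exact: linearB. Qed.
Lemma tlift0 : tlift bf 0 = 0.
Proof. exact: linear0. Qed.

Lemma tlift_unique (g : {linear tens -> P}) :
  (forall x y, g (tpure x y) = f x y) -> g =1 tlift bf.
Proof.
move=> gE; apply: tens_ind => [x y|q r IHq IHr|].
- by rewrite gE tliftE.
- by rewrite !linearD IHq IHr.
- by rewrite !linear0.
Qed.

End Lift.

End Tensor.

Arguments tpure {k M N}.

Section TensorMap.
Variables (k : comPzRingType) (M M' N N' : lmodType k).
Variables (f : {linear M -> M'}) (g : {linear N -> N'}).

Fact tmap_bilin : bilin (fun x y => tpure (f x) (g y)).
Proof.
split=> [x a y y'|y a x x'].
  by rewrite linearP tpureDr tpureZr.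
by rewrite /= linearP tpureDl tpureZl.
Qed.

Definition tmap : tens M N -> tens M' N' := tlift tmap_bilin.

HB.instance Definition _ := GRing.Linear.on tmap.

Lemma tmapD q r : tmap (q + r) = tmap q + tmap r.
Proof. exact: linearD. Qed.
Lemma tmap0 : tmap 0 = 0.
Proof. exact: linear0. Qed.

Lemma tmapE x y : tmap (tpure x y) = tpure (f x) (g y).
Proof. exact: tliftE. Qed.

End TensorMap.

Arguments tmap : simpl never.

(* A commutative algebra is a commutative ring under [k]; this way a ring can *)
(* be viewed as an algebra over several bases.                                *)
Record calg (k : comPzRingType) := CAlg {
  cring :> comPzRingType;
  cmap : {rmorphism k -> cring} }.

Record chom (k : comPzRingType) (S T : calg k) := CHom {
  chom_fun :> {rmorphism S -> T};
  chomE : forall a, chom_fun (cmap S a) = cmap T a }.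

Definition cmod (k : comPzRingType) (S : calg k) : lmodType k :=
  res (cmap S) S^o.

Section CommutativeAlgebras.
Variable k : comPzRingType.
Implicit Types S T U : calg k.

Lemma cmodZ S (a : k) (x : cmod S) : a *: x = cmap S a * (x : S).
Proof. by []. Qed.

Section Hom.
Variables (S T U : calg k) (p : chom S T) (q : chom T U).

Definition chom_lin (x : cmod S) : cmod T := p x.
Fact chom_lin_linear : linear chom_lin.
Proof. by move=> a x y; rewrite /chom_lin rmorphD cmodZ rmorphM chomE. Qed.
HB.instance Definition _ :=
  GRing.isLinear.Build k (cmod S) (cmod T) *:%R chom_lin chom_lin_linear.

Fact chom_compE a : (q \o p) (cmap S a) = cmap U a.
Proof. by rewrite /= !chomE. Qed.
Definition chom_comp : chom S U := CHom chom_compE.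

End Hom.

Section Mul.
Variables (S : calg k) (s : S).
Definition cmul (x : cmod S) : cmod S := s * (x : S).
Fact cmul_linear : linear cmul.
Proof. by move=> a x y; rewrite /cmul mulrDr mulrCA. Qed.
HB.instance Definition _ :=
  GRing.isLinear.Build k (cmod S) (cmod S) *:%R cmul cmul_linear.
End Mul.

Lemma cmulDl S (x y z : cmod S) : cmul (x + y : cmod S) z = cmul x z + cmul y z.
Proof. exact: mulrDl. Qed.
Lemma cmulZl S a (x z : cmod S) : cmul (a *: x : cmod S) z = a *: cmul x z.
Proof. exact: esym (mulrA _ _ _). Qed.

End CommutativeAlgebras.

(* Restriction of scalars along k -> R, for an R-algebra.                     *)
Definition res_calg (k : comPzRingType) (R : calg k) (S : calg R) : calg k :=
  CAlg (cmap S \o cmap R).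

Section ResHom.
Variables (k : comPzRingType) (R : calg k) (S T : calg R) (p : chom S T).
Fact res_chomE a : p (cmap (res_calg S) a) = cmap (res_calg T) a.
Proof. exact: chomE. Qed.
Definition res_chom : chom (res_calg S) (res_calg T) :=
  @CHom k (res_calg S) (res_calg T) p res_chomE.
End ResHom.

(* A homomorphism R -> R' makes R' an R-algebra.                              *)
Definition calg_over (k : comPzRingType) (R R' : calg k) (g : chom R R') : calg R :=
  CAlg g.

(* The tensor product of two commutative algebras.                            *)
Section TensorRing.
Variables (R : comPzRingType) (S T : calg R).

Definition ctens_ring : Type := tens (cmod S) (cmod T).
HB.instance Definition _ := GRing.Zmodule.on ctens_ring.

Fact ctens_mul_bilin (r : tens (cmod S) (cmod T)) :
  bilin (fun (x : cmod S) (y : cmod T) => tmap (cmul (x : S)) (cmul (y : T)) r).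
Proof.
split=> [x a y y'|y a x x'] /=.
  elim/tens_ind: r => [z w|r1 r2 h1 h2|].
  - by rewrite !tmapE /= -tpureZr -tpureDr cmulDl cmulZl.
  - by rewrite !tmapD h1 h2 scalerDr addrACA.
  - by rewrite !tmap0 scaler0 addr0.
elim/tens_ind: r => [z w|r1 r2 h1 h2|].
- by rewrite !tmapE /= -tpureZl -tpureDl cmulDl cmulZl.
- by rewrite !tmapD h1 h2 scalerDr addrACA.
- by rewrite !tmap0 scaler0 addr0.
Qed.

Definition ctens_mul (q r : ctens_ring) : ctens_ring :=
  tlift (ctens_mul_bilin r) q.

Definition ctens_one : ctens_ring := tpure (1 : cmod S) (1 : cmod T).

Lemma ctens_mulE (x x' : cmod S) (y y' : cmod T) :
  ctens_mul (tpure x y) (tpure x' y') =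
  tpure ((x * x' : S) : cmod S) ((y * y' : T) : cmod T).
Proof. by rewrite /ctens_mul tliftE tmapE. Qed.

Lemma ctens_mulDl : left_distributive ctens_mul +%R.
Proof. by move=> q q' r; rewrite /ctens_mul; apply: linearD. Qed.

Fact ctens_mulC : commutative ctens_mul.
Proof.
have mulDr q r r' : ctens_mul q (r + r') = ctens_mul q r + ctens_mul q r'.
  elim/tens_ind: q => [x y|q q' h h'|].
  - by rewrite /ctens_mul !tliftE; apply: linearD.
  - by rewrite !ctens_mulDl h h' addrACA.
  - by rewrite /ctens_mul !linear0 addr0.
have mul0 q : ctens_mul q 0 = 0.
  by apply: (addrI (ctens_mul q 0)); rewrite -mulDr !addr0.
move=> q r; elim/tens_ind: q => [x y|q q' h h'|].
- elim/tens_ind: r => [x' y'|r r' h h'|].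
  + by rewrite !ctens_mulE (mulrC (x : S)) (mulrC (y : T)).
  + by rewrite mulDr ctens_mulDl h h'.
  + by rewrite mul0 /ctens_mul linear0.
- by rewrite mulDr ctens_mulDl h h'.
- by rewrite mul0 /ctens_mul linear0.
Qed.

Lemma ctens_mulDr : right_distributive ctens_mul +%R.
Proof. by move=> q r r'; rewrite ctens_mulC ctens_mulDl !(ctens_mulC q). Qed.
Lemma ctens_mul0l q : ctens_mul 0 q = 0.
Proof. by rewrite /ctens_mul linear0. Qed.
Lemma ctens_mul0r q : ctens_mul q 0 = 0.
Proof. by rewrite ctens_mulC ctens_mul0l. Qed.

Fact ctens_mulA : associative ctens_mul.
Proof.
move=> q r s; elim/tens_ind: q => [x y|q q' h h'|].
- elim/tens_ind: r => [x' y'|r r' h h'|].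
  + elim/tens_ind: s => [x2 y2|s s' h h'|].
    * by rewrite !ctens_mulE !mulrA.
    * by rewrite !ctens_mulDr h h'.
    * by rewrite !ctens_mul0r.
  + by rewrite !(ctens_mulDl, ctens_mulDr) h h'.
  + by rewrite !(ctens_mul0l, ctens_mul0r).
- by rewrite !ctens_mulDl h h'.
- by rewrite !ctens_mul0l.
Qed.

Fact ctens_mul1 : left_id ctens_one ctens_mul.
Proof.
move=> q; elim/tens_ind: q => [x y|q q' h h'|].
- by rewrite ctens_mulE !mul1r.
- by rewrite ctens_mulDr h h'.
- by rewrite ctens_mul0r.
Qed.

HB.instance Definition _ := GRing.Zmodule_isComPzRing.Build ctens_ring
  ctens_mulA ctens_mulC ctens_mul1 ctens_mulDl.

Definition ctens_inl (x : S) : ctens_ring := tpure (x : cmod S) (1 : cmod T).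
Definition ctens_inr (y : T) : ctens_ring := tpure (1 : cmod S) (y : cmod T).

Fact ctens_inl_additive : zmod_morphism ctens_inl.
Proof.
have D (x y : S) : ctens_inl (x + y) = ctens_inl x + ctens_inl y.
  exact: (tpureDl (x : cmod S) (y : cmod S) (1 : cmod T)).
by move=> x y; apply: (addIr (ctens_inl y)); rewrite subrK -D subrK.
Qed.
Fact ctens_inl_mult : monoid_morphism ctens_inl.
Proof. by split=> // x y; rewrite [RHS]ctens_mulE mulr1. Qed.
HB.instance Definition _ :=
  GRing.isZmodMorphism.Build S ctens_ring ctens_inl ctens_inl_additive.
HB.instance Definition _ :=
  GRing.isMonoidMorphism.Build S ctens_ring ctens_inl ctens_inl_mult.

Fact ctens_inr_additive : zmod_morphism ctens_inr.
Proof.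
have D (x y : T) : ctens_inr (x + y) = ctens_inr x + ctens_inr y.
  exact: (tpureDr (1 : cmod S) (x : cmod T) (y : cmod T)).
by move=> x y; apply: (addIr (ctens_inr y)); rewrite subrK -D subrK.
Qed.
Fact ctens_inr_mult : monoid_morphism ctens_inr.
Proof. by split=> // x y; rewrite [RHS]ctens_mulE mulr1. Qed.
HB.instance Definition _ :=
  GRing.isZmodMorphism.Build T ctens_ring ctens_inr ctens_inr_additive.
HB.instance Definition _ :=
  GRing.isMonoidMorphism.Build T ctens_ring ctens_inr ctens_inr_mult.

Definition ctens : calg R := @CAlg R ctens_ring (ctens_inl \o cmap S).

Definition inl_chom : chom S ctens :=
  @CHom R S ctens ctens_inl (fun=> erefl).

Fact inr_chomE a : ctens_inr (cmap T a) = cmap ctens a.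
Proof.
rewrite /= /ctens_inl /ctens_inr.
have -> : cmap T a = a *: (1 : cmod T) by rewrite cmodZ mulr1.
have -> : cmap S a = a *: (1 : cmod S) by rewrite cmodZ mulr1.
by rewrite tpureZl tpureZr.
Qed.
Definition inr_chom : chom T ctens := @CHom R T ctens ctens_inr inr_chomE.

(* s (x) t |-> i s * j t                                                      *)
Section Copair.
Variables (B : calg R) (i : chom S B) (j : chom T B).

Fact copair_bilin :
  bilin (fun (x : cmod S) (y : cmod T) => (i x * j y : B) : cmod B).
Proof.
split=> [x a y y'|y a x x'] /=.
  by rewrite !cmodZ rmorphD rmorphM chomE mulrDr mulrCA.
by rewrite !cmodZ rmorphD rmorphM chomE mulrDl mulrA.
Qed.

Definition copair_fun (q : ctens) : B := tlift copair_bilin q.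

Lemma copair_funE (x : S) (y : T) :
  copair_fun (tpure (x : cmod S) (y : cmod T)) = i x * j y.
Proof. by rewrite /copair_fun tliftE. Qed.

Fact copair_additive : zmod_morphism copair_fun.
Proof. exact: (tliftB copair_bilin). Qed.
Fact copair_mult : monoid_morphism copair_fun.
Proof.
split=> [|q r]; first by rewrite copair_funE !rmorph1 mulr1.
have D q1 q2 : copair_fun (q1 + q2) = copair_fun q1 + copair_fun q2.
  exact: (tliftD copair_bilin).
have Z : copair_fun 0 = 0 by apply: (tlift0 copair_bilin).
elim/tens_ind: q => [x y|q q' h h'|].
- elim/tens_ind: r => [x' y'|r r' h h'|].
  + have -> : (tpure x y : ctens) * (tpure x' y' : ctens) =
      tpure ((x * x' : S) : cmod S) ((y * y' : T) : cmod T).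
      exact: ctens_mulE.
    by rewrite !copair_funE !rmorphM mulrACA.
  + by rewrite mulrDr !D h h' mulrDr.
  + by rewrite mulr0 Z mulr0.
- by rewrite mulrDl !D h h' mulrDl.
- by rewrite mul0r Z mul0r.
Qed.
HB.instance Definition _ :=
  GRing.isZmodMorphism.Build ctens B copair_fun copair_additive.
HB.instance Definition _ :=
  GRing.isMonoidMorphism.Build ctens B copair_fun copair_mult.

Fact copair_chomE a : copair_fun (cmap ctens a) = cmap B a.
Proof. by rewrite copair_funE chomE rmorph1 mulr1. Qed.

Definition copair : chom ctens B := @CHom R ctens B copair_fun copair_chomE.

End Copair.

End TensorRing.

(* An algebra is not assumed associative, commutative or unital.              *)
Record alg (k : comPzRingType) := Alg {
  amod :> lmodType k;
  amul : amod -> amod -> amod;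
  amul_bilin : bilin amul }.

Section AlgebraTheory.
Variables (k : comPzRingType) (L : alg k).

HB.instance Definition _ (x : L) :=
  GRing.isLinear.Build k L L *:%R (amul x) ((amul_bilin L).1 x).

Lemma amulDl (x y z : L) : amul (x + y) z = amul x z + amul y z.
Proof. exact: (bilinDl (amul_bilin L)). Qed.
Lemma amulDr (x y z : L) : amul x (y + z) = amul x y + amul x z.
Proof. exact: (bilinDr (amul_bilin L)). Qed.
Lemma amulZl a (x y : L) : amul (a *: x) y = a *: amul x y.
Proof. exact: (bilinZl (amul_bilin L)). Qed.
Lemma amulZr a (x y : L) : amul x (a *: y) = a *: amul x y.
Proof. exact: (bilinZr (amul_bilin L)). Qed.
Lemma amul0l (x : L) : amul 0 x = 0.
Proof. exact: (bilin0l (amul_bilin L)). Qed.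
Lemma amul0r (x : L) : amul x 0 = 0.
Proof. exact: (bilin0r (amul_bilin L)). Qed.

End AlgebraTheory.

Section ResAlg.
Variables (k : comPzRingType) (R : calg k) (L : alg R).

Fact res_amul_bilin :
  @bilin k (res (cmap R) L) (res (cmap R) L) (res (cmap R) L) (@amul R L).
Proof.
split=> [x a y y'|y a x x']; first exact: (amul_bilin L).1.
exact: (amul_bilin L).2.
Qed.

Definition res_alg : alg k := Alg res_amul_bilin.

End ResAlg.

Section CalgAlg.
Variables (k : comPzRingType) (S : calg k).

Fact calg_mul_bilin : @bilin k (cmod S) (cmod S) (cmod S) (@cmul k S).
Proof.
split=> [x a y y'|y a x x']; first exact: cmul_linear.
by rewrite cmulDl cmulZl.
Qed.

Definition calg_alg : alg k := Alg calg_mul_bilin.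

End CalgAlg.

(* Base change of an algebra.                                                 *)
Section BaseChange.
Variables (k : comPzRingType) (A : alg k) (S : calg k).

Definition bc_mod : Type := tens A (cmod S).
HB.instance Definition _ := GRing.Zmodule.on bc_mod.

Definition bc_scale (s : S) (q : bc_mod) : bc_mod :=
  tmap (idfun : {linear A -> A}) (cmul s) q.

Lemma bc_scale_pure (s : S) x (t : cmod S) :
  bc_scale s (tpure x t) = tpure x (cmul s t).
Proof. exact: tmapE. Qed.

Fact bc_scaleDr : right_distributive bc_scale +%R.
Proof. by move=> s; exact: (tmapD (idfun : {linear A -> A}) (cmul s)). Qed.
Lemma bc_scale0r s : bc_scale s 0 = 0.
Proof. exact: (tmap0 (idfun : {linear A -> A}) (cmul s)). Qed.
Fact bc_scaleA s t q : bc_scale s (bc_scale t q) = bc_scale (s * t) q.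
Proof.
elim/tens_ind: q => [x y|q r h h'|].
- by rewrite !bc_scale_pure /cmul mulrA.
- by rewrite !bc_scaleDr h h'.
- by rewrite !bc_scale0r.
Qed.
Fact bc_scale1 : left_id 1 bc_scale.
Proof.
move=> q; elim/tens_ind: q => [x y|q r h h'|].
- by rewrite !bc_scale_pure /cmul mul1r.
- by rewrite !bc_scaleDr h h'.
- by rewrite !bc_scale0r.
Qed.
Fact bc_scaleDl q : {morph bc_scale^~ q : s t / s + t}.
Proof.
move=> s t /=; elim/tens_ind: q => [x y|q r h h'|].
- by rewrite !bc_scale_pure cmulDl tpureDr.
- by rewrite !bc_scaleDr h h' addrACA.
- by rewrite !bc_scale0r addr0.
Qed.

HB.instance Definition _ := GRing.Zmodule_isLmodule.Build S bc_mod
  bc_scaleA bc_scale1 bc_scaleDr bc_scaleDl.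

Definition bcpure (x : A) (s : S) : bc_mod := tpure x (s : cmod S).

Lemma bcpureZ (s t : S) x : s *: bcpure x t = bcpure x (s * t).
Proof. exact: bc_scale_pure. Qed.

Lemma bc_ind (P : bc_mod -> Prop) :
  (forall x s, P (bcpure x s)) -> (forall q r, P q -> P r -> P (q + r)) ->
  P 0 -> forall q, P q.
Proof. exact: (@tens_ind k A (cmod S) P). Qed.

Fact bc_mul_bilin0 (r : tens A (cmod S)) :
  bilin (fun (x : A) (s : cmod S) => tmap (amul x) (cmul (s : S)) r).
Proof.
split=> [x a y y'|y a x x'] /=.
  elim/tens_ind: r => [z w|r1 r2 h1 h2|].
  - by rewrite !tmapE /= -tpureZr -tpureDr cmulDl cmulZl.
  - by rewrite !tmapD h1 h2 scalerDr addrACA.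
  - by rewrite !tmap0 scaler0 addr0.
elim/tens_ind: r => [z w|r1 r2 h1 h2|].
- by rewrite !tmapE /= -tpureZl -tpureDl amulDl amulZl.
- by rewrite !tmapD h1 h2 scalerDr addrACA.
- by rewrite !tmap0 scaler0 addr0.
Qed.

(* (x (x) s) (y (x) t) = (x y) (x) (s t)                                      *)
Definition bc_mul (q r : bc_mod) : bc_mod := tlift (bc_mul_bilin0 r) q.

Lemma bc_mulE x y s t :
  bc_mul (bcpure x s) (bcpure y t) = bcpure (amul x y) (s * t).
Proof. by rewrite /bc_mul tliftE tmapE. Qed.

Lemma bc_mulDl q q' r : bc_mul (q + q') r = bc_mul q r + bc_mul q' r.
Proof. exact: (tliftD (bc_mul_bilin0 r)). Qed.
Lemma bc_mul0l r : bc_mul 0 r = 0.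
Proof. exact: (tlift0 (bc_mul_bilin0 r)). Qed.
Lemma bc_mulDr q r r' : bc_mul q (r + r') = bc_mul q r + bc_mul q r'.
Proof.
elim/bc_ind: q => [x y|q q' h h'|].
- by rewrite /bc_mul !tliftE; apply: tmapD.
- by rewrite !bc_mulDl h h' addrACA.
- by rewrite !bc_mul0l addr0.
Qed.
Lemma bc_mul0r q : bc_mul q 0 = 0.
Proof. by apply: (addrI (bc_mul q 0)); rewrite -bc_mulDr !addr0. Qed.

Lemma bc_mulZl (a : S) q r : bc_mul (a *: q) r = a *: bc_mul q r.
Proof.
elim/bc_ind: q => [x s|q q' h h'|].
- elim/bc_ind: r => [y t|r r' h h'|].
  + by rewrite bcpureZ !bc_mulE bcpureZ mulrA.
  + by rewrite !bc_mulDr h h' scalerDr.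
  + by rewrite !bc_mul0r scaler0.
- by rewrite scalerDr !bc_mulDl h h' scalerDr.
- by rewrite scaler0 !bc_mul0l scaler0.
Qed.
Lemma bc_mulZr (a : S) q r : bc_mul q (a *: r) = a *: bc_mul q r.
Proof.
elim/bc_ind: q => [x s|q q' h h'|].
- elim/bc_ind: r => [y t|r r' h h'|].
  + by rewrite bcpureZ !bc_mulE bcpureZ mulrCA.
  + by rewrite scalerDr !bc_mulDr h h' scalerDr.
  + by rewrite scaler0 !bc_mul0r scaler0.
- by rewrite !bc_mulDl h h' scalerDr.
- by rewrite !bc_mul0l scaler0.
Qed.

Fact bc_mul_bilin : @bilin S bc_mod bc_mod bc_mod bc_mul.
Proof.
split=> [x a y y'|y a x x'] /=; first by rewrite bc_mulDr bc_mulZr.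
by rewrite bc_mulDl bc_mulZl.
Qed.

Definition bc : alg S := Alg bc_mul_bilin.

End BaseChange.

(* id_A (x) p                                                                 *)
Section BaseChangeMap.
Variables (k : comPzRingType) (A : alg k) (S T : calg k) (p : chom S T).

Definition bcmap (q : bc A S) : bc A T :=
  tmap (idfun : {linear A -> A}) (chom_lin p) q.

Lemma bcmapE x (s : S) : bcmap (bcpure x s) = bcpure x (p s).
Proof. exact: tmapE. Qed.
Lemma bcmapD q r : bcmap (q + r) = bcmap q + bcmap r.
Proof. exact: (tmapD (idfun : {linear A -> A}) (chom_lin p)). Qed.
Lemma bcmap0 : bcmap 0 = 0.
Proof. exact: (tmap0 (idfun : {linear A -> A}) (chom_lin p)). Qed.
Lemma bcmapZ (s : S) q : bcmap (s *: q) = p s *: bcmap q.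
Proof.
elim/bc_ind: q => [x t|q r h h'|].
- by rewrite bcpureZ !bcmapE bcpureZ rmorphM.
- by rewrite scalerDr !bcmapD h h' scalerDr.
- by rewrite scaler0 bcmap0 scaler0.
Qed.
Lemma bcmapM q r : bcmap (amul q r) = amul (bcmap q) (bcmap r).
Proof.
elim/bc_ind: q => [x s|q q' h h'|].
- elim/bc_ind: r => [y t|r r' h h'|].
  + by rewrite /= bc_mulE !bcmapE bc_mulE rmorphM.
  + by rewrite !(amulDr, bcmapD) h h'.
  + by rewrite !(amul0r, bcmap0).
- by rewrite !(amulDl, bcmapD) h h'.
- by rewrite !(amul0l, bcmap0).
Qed.

End BaseChangeMap.

Record aut (k : comPzRingType) (L : alg k) := Aut {
  aut_fun :> {linear L -> L};
  autM : forall x y, aut_fun (amul x y) = amul (aut_fun x) (aut_fun y);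
  aut_bij : bijective aut_fun }.

(* The functoriality of Aut(A) in the base: the image of u is the T-linear    *)
(* extension of u, that is a (x) t |-> t (id (x) p)(u (a (x) 1)).             *)
Section AutBaseChange.
Variables (k : comPzRingType) (A : alg k) (S T : calg k) (p : chom S T).

Section Extension.
Variable u : {linear bc A S -> bc A S}.

Fact bc_ext_bilin :
  @bilin k A (cmod T) (tens A (cmod T))
    (fun x t => (t : T) *: bcmap p (u (bcpure x (1 : S)))).
Proof.
have scE a (q : bc A T) : (cmap T a *: q : bc A T) = (a *: (q : tens A (cmod T))).
  elim/bc_ind: q => [x s|q r h h'|].
  - by rewrite bcpureZ -[LHS]/(tpure x (a *: (s : cmod T))) tpureZr.
  - rewrite scalerDr h h'; exact: (esym (@scalerDr k (tens A (cmod T)) a q r)).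
  - rewrite scaler0; exact: (esym (@scaler0 k (tens A (cmod T)) a)).
split=> [x a y y'|y a x x'] /=.
  rewrite -scE scalerA.
  exact: (@scalerDl T (bc A T) _ (cmap T a * (y : T)) y').
have -> : bcpure (a *: x + x') (1 : S) = cmap S a *: bcpure x 1 + bcpure x' 1.
  rewrite bcpureZ mulr1 /bcpure tpureDl tpureZl -tpureZr.
  by congr (tpure _ _ + _); rewrite cmodZ mulr1.
rewrite linearP bcmapD bcmapZ chomE scalerDr; congr (_ + _).
by rewrite -scE !scalerA mulrC.
Qed.

Definition bc_ext (q : bc A T) : bc A T := tlift bc_ext_bilin q.

Lemma bc_ext_pure x (t : T) :
  bc_ext (bcpure x t) = t *: bcmap p (u (bcpure x 1)).
Proof. exact: (tliftE bc_ext_bilin x (t : cmod T)). Qed.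
Lemma bc_extD q r : bc_ext (q + r) = bc_ext q + bc_ext r.
Proof. exact: (tliftD bc_ext_bilin). Qed.
Lemma bc_ext0 : bc_ext 0 = 0.
Proof. exact: (tlift0 bc_ext_bilin). Qed.
Lemma bc_extZ (t : T) q : bc_ext (t *: q) = t *: bc_ext q.
Proof.
elim/bc_ind: q => [x s|q r h h'|].
- by rewrite bcpureZ !bc_ext_pure scalerA.
- by rewrite scalerDr !bc_extD h h' scalerDr.
- by rewrite scaler0 bc_ext0 scaler0.
Qed.
Fact bc_ext_linear : linear bc_ext.
Proof. by move=> a q r; rewrite bc_extD bc_extZ. Qed.
HB.instance Definition _ :=
  GRing.isLinear.Build T (bc A T) (bc A T) *:%R bc_ext bc_ext_linear.

Lemma bc_ext_map q : bc_ext (bcmap p q) = bcmap p (u q).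
Proof.
elim/bc_ind: q => [x s|q r h h'|].
- by rewrite bcmapE bc_ext_pure -bcmapZ -linearZ bcpureZ mulr1.
- by rewrite bcmapD bc_extD h h' -bcmapD -linearD.
- by rewrite bcmap0 bc_ext0 linear0 bcmap0.
Qed.

End Extension.

Lemma bc_ext_can (u v : {linear bc A S -> bc A S}) :
  cancel u v -> cancel (bc_ext u) (bc_ext v).
Proof.
move=> uK q; elim/bc_ind: q => [x t|q r h h'|].
- by rewrite bc_ext_pure bc_extZ bc_ext_map uK bcmapE rmorph1 bcpureZ mulr1.
- by rewrite !bc_extD h h'.
- by rewrite !bc_ext0.
Qed.

Variable u : aut (bc A S).

Fact bc_ext_mul q r :
  bc_ext u (amul q r) = amul (bc_ext u q) (bc_ext u r).
Proof.
elim/bc_ind: q => [x s|q q' h h'|].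
- elim/bc_ind: r => [y t|r r' h h'|].
  + rewrite /= bc_mulE !bc_ext_pure bc_mulZl bc_mulZr scalerA; congr (_ *: _).
    rewrite -[bc_mul _ _]bcmapM -autM; congr (bcmap p (u _)).
    by rewrite /= bc_mulE mulr1.
  + by rewrite amulDr !bc_extD amulDr h h'.
  + by rewrite amul0r !bc_ext0 amul0r.
- by rewrite amulDl !bc_extD amulDl h h'.
- by rewrite amul0l !bc_ext0 amul0l.
Qed.

Fact bc_ext_bij : bijective (bc_ext u).
Proof.
have [v uK vK] := aut_bij u.
have v_lin : linear v by move=> a x y; apply: (can_inj uK); rewrite linearP !vK.
pose vL := GRing.isLinear.Build S (bc A S) (bc A S) *:%R v v_lin.
pose w : {linear bc A S -> bc A S} := HB.pack v vL.
by exists (bc_ext w); apply: bc_ext_can.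
Qed.

Definition aut_map : aut (bc A T) := Aut bc_ext_mul bc_ext_bij.

End AutBaseChange.

Fact comm_sum (V : zmodType) (p q r s p' s' : V) :
  p + q + (r + s) - (p' + r + (q + s')) = p - p' + (s - s').
Proof.
rewrite [p + q + _]addrACA opprD [LHS]addrACA !opprD.
by rewrite [p + r + _]addrACA subrr addr0 [q + s + _]addrACA subrr add0r.
Qed.

Section Derivations.
Variables (k : comPzRingType) (L : alg k).

Definition is_der (d : L -> L) : Prop :=
  linear d /\ forall x y, d (amul x y) = amul (d x) y + amul x (d y).

Definition der_pred : pred (L -> L) := fun d => `[< is_der d >].

Fact der_submod_closed : submod_closed der_pred.
Proof.
split=> [|a d e].
  apply/asboolP; split=> [b x y|x y] /=; first by rewrite scaler0 addr0.
  by rewrite amul0l amul0r addr0.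
move=> /asboolP [dl dM] /asboolP [el eM]; apply/asboolP.
have fE z : (a *: d + e) z = a *: d z + e z by [].
split=> [b x y|x y]; rewrite !fE.
  by rewrite dl el !scalerDr !scalerA [a * b]mulrC addrACA.
by rewrite dM eM amulDl amulDr amulZl amulZr scalerDr addrACA.
Qed.

HB.instance Definition _ :=
  GRing.isSubmodClosed.Build k (L -> L) der_pred der_submod_closed.

(* Der_k(L)                                                                   *)
Record der : Type := Der { der_fun :> L -> L; _ : der_pred der_fun }.

HB.instance Definition _ := [isSub for der_fun].
HB.instance Definition _ := [Choice of der by <:].
HB.instance Definition _ := [SubChoice_isSubLmodule of der by <:].

Lemma der_funP (d : der) : is_der d.
Proof. by case: d => d /= /asboolP. Qed.

Lemma derM (d : der) x y : d (amul x y) = amul (d x) y + amul x (d y).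
Proof. exact: (der_funP d).2. Qed.

HB.instance Definition _ (d : der) :=
  GRing.isLinear.Build k L L *:%R (der_fun d) (der_funP d).1.

Lemma derZ (d : der) a x : d (a *: x) = a *: d x.
Proof. exact: linearZZ. Qed.

Lemma der_inj (d e : der) : d =1 e -> d = e.
Proof. by move=> h; apply: val_inj; apply/funext. Qed.

Lemma is_der_pred (f : L -> L) : is_der f -> der_pred f.
Proof. by move=> h; apply/asboolP. Qed.

Definition commutator (f g : L -> L) : L -> L := fun x => f (g x) - g (f x).

Fact der_br_subproof (d e : der) : der_pred (commutator d e).
Proof.
apply: is_der_pred; split=> [a x y|x y]; rewrite /commutator.
  by rewrite !(linearP d, linearP e) scalerBr opprD addrACA.
have aB (a b c : L) : amul (a - b) c = amul a c - amul b c.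
  by apply: (addIr (amul b c)); rewrite subrK -amulDl subrK.
have aB' (a b c : L) : amul a (b - c) = amul a b - amul a c.
  by apply: (addIr (amul a c)); rewrite subrK -amulDr subrK.
rewrite !derM (linearD d) (linearD e) /= !derM aB aB'.
exact: comm_sum.
Qed.
Definition der_br (d e : der) : der := Der (der_br_subproof d e).

End Derivations.

Section LieStructure.
Variables (k : comPzRingType) (L : alg k).

Definition lie_submodule (B : set (der L)) : Prop :=
  B 0 /\ forall a x y, B x -> B y -> B (a *: x + y).
Definition lie_subalgebra (B : set (der L)) : Prop :=
  lie_submodule B /\ forall x y, B x -> B y -> B (der_br x y).
Definition lie_ideal (B : set (der L)) : Prop :=
  lie_submodule B /\ forall x y, B y -> B (der_br x y).

(* Der_k(L) is the internal semidirect product of the ideal I by the          *)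
(* subalgebra B.                                                              *)
Definition semidirect (I B : set (der L)) : Prop :=
  [/\ lie_ideal I, lie_subalgebra B,
      forall x, I x -> B x -> x = 0
    & forall x, exists y z, [/\ I y, B z & x = y + z]].

Definition centroid : set (L -> L) :=
  [set c | linear c /\
    forall x y, c (amul x y) = amul (c x) y /\ c (amul x y) = amul x (c y)].

End LieStructure.

Arguments centroid {k} L.

(* In the rest of this section L is an R-algebra and R is a k-algebra.        *)
Section RelativeDerivations.
Variables (k : comPzRingType) (R : calg k) (L : alg R).

Fact der_res_subproof (d : der L) : @der_pred k (res_alg L) d.
Proof.
apply/asboolP; split=> [a x y|x y]; last exact: (@derM R L d x y).
exact: ((der_funP d).1 (cmap R a) x y).
Qed.

(* The inclusion of Der_R(L) into Der_k(L).                                   *)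
Definition der_res (d : der L) : der (res_alg L) :=
  @Der k (res_alg L) d (der_res_subproof d).

Definition chi (r : R) : L -> L := fun x => r *: x.

Definition chi_iso : Prop :=
  set_bij [set: R] (centroid (res_alg L)) chi.

(* The derivation e of R such that [d, chi r] = chi (e r) for all r. It       *)
(* exists and is unique when chi is an isomorphism onto the centroid, see     *)
(* [etaP]; the value is 0 if there is no such derivation.                     *)
Definition eta (d : der (res_alg L)) : der (calg_alg R) :=
  xget 0 [set e : der (calg_alg R) |
    forall r : R, commutator d (chi r) = chi (e r)]%classic.

Hypothesis chiP : chi_iso.

Lemma chi_inj : injective chi.
Proof. by case: chiP => _ h _ r s; apply: h; rewrite inE. Qed.

Fact comm_centroid (d : der (res_alg L)) r :
  centroid (res_alg L) (commutator d (chi r)).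
Proof.
have [dl dM] := der_funP d.
split=> [a x y|x y]; rewrite /commutator /chi.
  have -> : (a *: x + y : res_alg L) = cmap R a *: (x : L) + y by [].
  rewrite scalerDr scalerA mulrC -scalerA.
  have E z w : d (cmap R a *: z + w) = cmap R a *: (d z : L) + d w :> L.
    exact: dl.
  rewrite !E; rewrite scalerDr scalerA (mulrC r) -scalerA.
  have -> z : a *: z = cmap R a *: (z : L) :> res_alg L by [].
  by rewrite opprD [LHS]addrACA scalerBr.
have E z w : d (amul (z : L) w) = amul (d z : L) w + amul (z : L) (d w) :> L.
  exact: dM.
have B1 (a b c : L) : amul (a - b) c = amul a c - amul b c.
  by apply: (addIr (amul b c)); rewrite subrK -amulDl subrK.
have B2 (a b c : L) : amul a (b - c) = amul a b - amul a c.
  by apply: (addIr (amul a c)); rewrite subrK -amulDr subrK.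
have E1 (z w : L) : r *: amul z w = amul (r *: z) w by rewrite amulZl.
have E2 (z w : L) : r *: amul z w = amul z (r *: w) by rewrite amulZr.
split.
  have -> : d (r *: amul (x : L) y) = amul (d (r *: (x : L)) : L) y + amul (r *: (x : L)) (d y).
    by rewrite E1 E.
  by rewrite E scalerDr !E1 opprD [LHS]addrACA subrr addr0 -B1.
have -> : d (r *: amul (x : L) y) = amul (d x : L) (r *: (y : L)) + amul (x : L) (d (r *: (y : L)) : L).
  by rewrite E2 E.
by rewrite E scalerDr !E2 opprD [LHS]addrACA subrr add0r -B2.
Qed.

Lemma etaP (d : der (res_alg L)) r : commutator d (chi r) = chi (eta d r).
Proof.
have chi_onto c : centroid (res_alg L) c -> exists s, chi s = c.
  by case: chiP => _ _ h /h [s _ <-]; exists s.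
have [f fE] : {f : R -> R & forall r, chi (f r) = commutator d (chi r)}.
  apply: (choice (P := fun s t => chi t = commutator d (chi s))) => s.
  by apply: chi_onto; apply: comm_centroid.
have fD x s : (f s) *: x = d (s *: x) - s *: (d x : L) :> L.
  exact: (congr1 (fun g : L -> L => g x) (fE s)).
have dl a (x y : L) : d (cmap R a *: x + y) = cmap R a *: (d x : L) + d y :> L.
  exact: (der_funP d).1.
have dD (x y : L) : d (x + y) = (d x : L) + d y :> L.
  by have := dl 1 x y; rewrite rmorph1 !scale1r.
have dZ a (x : L) : d (cmap R a *: x) = cmap R a *: (d x : L) :> L.
  have d0 : d 0 = 0 :> L by apply: (addrI (d 0 : L)); rewrite -dD !addr0.
  by have := dl a x 0; rewrite d0 !addr0.
have f_der : @is_der k (calg_alg R) f.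
  suff [fl fM] : (forall a s t, f (cmap R a * s + t) = cmap R a * f s + f t) /\
      (forall s t, f (s * t) = f s * t + s * f t) by split.
  split=> [a s t|s t].
    apply: chi_inj; apply/funext => x; rewrite /chi [LHS]fD.
    rewrite !scalerDl -!scalerA dD dZ !fD opprD [LHS]addrACA.
    by rewrite scalerBr.
  apply: chi_inj; apply/funext => x; rewrite /chi.
  rewrite [LHS]fD scalerDl -!scalerA !fD scalerBr.
  by rewrite addrA subrK.
have e_ex : exists e : der (calg_alg R), forall r : R, commutator d (chi r) = chi (e r).
  by exists (Der (is_der_pred f_der)) => s; rewrite fE.
exact: (xgetPex 0 e_ex).
Qed.

Lemma eta_unique (d : der (res_alg L)) (e : der (calg_alg R)) :
  (forall r, commutator d (chi r) = chi (e r)) -> eta d = e.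
Proof. by move=> eE; apply: der_inj => r; apply: chi_inj; rewrite -etaP eE. Qed.

Lemma eta_linear : linear eta.
Proof.
move=> a d e; apply: eta_unique => r; apply/funext => x.
have dE := congr1 (fun g : L -> L => g x) (etaP d r); have eE := congr1 (fun g : L -> L => g x) (etaP e r).
rewrite /commutator /chi in dE eE *.
rewrite -[(a *: eta d + eta e) r]/(cmap R a * eta d r + eta e r).
rewrite scalerDl -scalerA -dE -eE.
rewrite -[(a *: d + e) (r *: x)]/(cmap R a *: (d (r *: x) : L) + e (r *: x)).
rewrite -[(a *: d + e) x]/(cmap R a *: (d x : L) + e x).
by rewrite scalerDr !scalerBr !scalerA (mulrC r) opprD [LHS]addrACA.
Qed.

Lemma eta_br d e : eta (der_br d e) = der_br (eta d) (eta e).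
Proof.
apply: eta_unique => r; apply/funext => x.
have E (d' : der (res_alg L)) (s : R) (y : L) :
  d' (s *: y) = eta d' s *: y + s *: (d' y : L) :> L.
  by have := congr1 (fun g : L -> L => g y) (etaP d' s); rewrite /commutator /chi => <-; rewrite subrK.
have B (d' : der (res_alg L)) (y z : L) : d' (y + z) = (d' y : L) + d' z :> L.
  exact: (linearD d').
rewrite /commutator /chi /= /commutator.
rewrite !E !B !E comm_sum scalerBr addrK.
by rewrite -[RHS]/((eta d (eta e r) - eta e (eta d r)) *: (x : L)) scalerBl.
Qed.

End RelativeDerivations.

Definition flat_mod (R : comPzRingType) (M : lmodType R) : Prop :=
  forall (N1 N2 N3 : lmodType R) (f : {linear N1 -> N2}) (g : {linear N2 -> N3}),
  exact f g ->
  exact (tmap f (idfun : {linear M -> M})) (tmap g (idfun : {linear M -> M})).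

Definition faithfully_flat_mod (R : comPzRingType) (M : lmodType R) : Prop :=
  forall (N1 N2 N3 : lmodType R) (f : {linear N1 -> N2}) (g : {linear N2 -> N3}),
  exact f g <->
  exact (tmap f (idfun : {linear M -> M})) (tmap g (idfun : {linear M -> M})).

Section Etale.
Variable R : comPzRingType.

Definition flat (S : calg R) : Prop := flat_mod (cmod S).
Definition faithfully_flat (S : calg R) : Prop := faithfully_flat_mod (cmod S).

Definition surjective (X Y : Type) (f : X -> Y) : Prop :=
  forall y, exists x, f x = y.

(* Hom_R(S, B) -> Hom_R(S, C) is bijective for every surjection of R-algebras *)
(* B -> C whose kernel has square zero.                                       *)
Definition formally_etale (S : calg R) : Prop :=
  forall (B C : calg R) (p : chom B C),
  surjective p -> (forall x y, p x = 0 -> p y = 0 -> x * y = 0) ->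
  forall j : chom S C,
  (exists h : chom S B, forall s, p (h s) = j s) /\
  (forall h h' : chom S B,
    (forall s, p (h s) = j s) -> (forall s, p (h' s) = j s) -> h =1 h').

(* P is a polynomial algebra calg_over R in the variables X_0, ..., X_(n-1). The   *)
(* universal property is used because [{mpoly R[n]}] requires R != 0.         *)
Definition polynomial_calg (n : nat) (P : calg R) (X : 'I_n -> P) : Prop :=
  forall (T : calg R) (t : 'I_n -> T),
  (exists h : chom P T, forall i, h (X i) = t i) /\
  (forall h h' : chom P T, (forall i, h (X i) = h' (X i)) -> h =1 h').

Definition fin_pres (S : calg R) : Prop :=
  exists (n m : nat) (P : calg R) (X : 'I_n -> P) (r : 'I_m -> P)
    (p : chom P S),
  [/\ polynomial_calg X, surjective p
    & forall x, p x = 0 <-> exists c : 'I_m -> P, x = \sum_i c i * r i].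

Definition etale (S : calg R) : Prop := formally_etale S /\ fin_pres S.

End Etale.

Lemma formally_etale_ctens (R : comPzRingType) (S T : calg R) :
  formally_etale S -> formally_etale T -> formally_etale (ctens S T).
Proof.
move=> feS feT B C p p_surj p_sq j.
pose jS := chom_comp (inl_chom S T) j; pose jT := chom_comp (inr_chom S T) j.
have tE (x : S) (y : T) : tpure (x : cmod S) (y : cmod T) =
    (inl_chom S T x : ctens S T) * inr_chom S T y :> ctens S T.
  by rewrite [RHS]ctens_mulE mulr1 mul1r.
have [[hS hSE] hSU] := feS B C p p_surj p_sq jS.
have [[hT hTE] hTU] := feT B C p p_surj p_sq jT.
split.
  exists (copair hS hT) => q; elim/tens_ind: q => [x y|q r h h'|].
  - by rewrite [copair _ _ _]copair_funE rmorphM hSE hTE tE rmorphM.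
  - by rewrite !rmorphD h h'.
  - by rewrite !rmorph0.
move=> h h' hE hE' q; elim/tens_ind: q => [x y|q r e e'|].
- rewrite tE !rmorphM; congr (_ * _).
    apply: (hSU (chom_comp (inl_chom S T) h) (chom_comp (inl_chom S T) h')).
      by move=> s; rewrite /= hE.
    by move=> s; rewrite /= hE'.
  apply: (hTU (chom_comp (inr_chom S T) h) (chom_comp (inr_chom S T) h')).
    by move=> s; rewrite /= hE.
  by move=> s; rewrite /= hE'.
- by rewrite !rmorphD e e'.
- by rewrite !rmorph0.
Qed.

(* The ring of dual numbers T[eps].                                           *)
Definition dual (T : comPzRingType) : Type := (T * T)%type.

Section Dual.
Variable T : comPzRingType.
HB.instance Definition _ := GRing.Zmodule.on (dual T).

Definition dual_mul (x y : dual T) : dual T :=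
  (x.1 * y.1, x.1 * y.2 + x.2 * y.1).

Fact dual_mulA : associative dual_mul.
Proof.
move=> [a b] [c d] [e f]; rewrite /dual_mul /= mulrA; congr (_, _).
by rewrite mulrDr mulrDl !mulrA addrA.
Qed.
Fact dual_mulC : commutative dual_mul.
Proof.
move=> [a b] [c d]; rewrite /dual_mul /= mulrC; congr (_, _).
by rewrite addrC mulrC (mulrC a).
Qed.
Fact dual_mul1 : left_id (1, 0) dual_mul.
Proof. by move=> [a b]; rewrite /dual_mul /= !mul1r mul0r addr0. Qed.
Fact dual_mulDl : left_distributive dual_mul +%R.
Proof.
move=> [a b] [c d] [e f]; rewrite /dual_mul; congr (_, _) => /=.
  by rewrite mulrDl.
by rewrite !mulrDl addrACA.
Qed.

HB.instance Definition _ := GRing.Zmodule_isComPzRing.Build (dual T)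
  dual_mulA dual_mulC dual_mul1 dual_mulDl.

Definition dual_fst (x : dual T) : T := x.1.
Fact dual_fst_additive : zmod_morphism dual_fst.
Proof. by []. Qed.
Fact dual_fst_mult : monoid_morphism dual_fst.
Proof. by []. Qed.
HB.instance Definition _ :=
  GRing.isZmodMorphism.Build (dual T) T dual_fst dual_fst_additive.
HB.instance Definition _ :=
  GRing.isMonoidMorphism.Build (dual T) T dual_fst dual_fst_mult.

End Dual.

Section DerivationExtension.
Variables (k : comPzRingType) (R S : calg k) (g : chom R S).

Definition extends (d : der (calg_alg R)) (d' : der (calg_alg S)) : Prop :=
  forall r : R, d' (g r) = g (d r).

(* The unique extension of d, see [der_extP]; the value is 0 if there is no   *)
(* extension.                                                                 *)
Definition der_ext (d : der (calg_alg R)) : der (calg_alg S) :=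
  xget 0 [set d' | extends d d']%classic.

Lemma calg_derD (d : der (calg_alg S)) (x y : S) : d (x + y) = (d x : S) + d y.
Proof. exact: (linearD d). Qed.
Lemma calg_derM (d : der (calg_alg S)) (x y : S) :
  d (x * y) = (d x : S) * y + x * d y.
Proof. exact: (derM d). Qed.
Lemma calg_derZ (d : der (calg_alg S)) a (x : S) :
  d (cmap S a * x) = cmap S a * (d x : S).
Proof. exact: (derZ d a (x : cmod S)). Qed.
Lemma calg_der1 (d : der (calg_alg S)) : d (1 : S) = 0 :> S.
Proof.
apply: (addrI (d (1 : S) : S)).
by rewrite addr0 -{3}(mulr1 (1 : S)) calg_derM mulr1 mul1r.
Qed.

End DerivationExtension.

Section DerivationExtensionTheory.
Variables (k : comPzRingType) (R S : calg k) (g : chom R S).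
Hypothesis feS : formally_etale (calg_over g).

Section OneDerivation.
Variable d : der (calg_alg R).

Definition dual_map (r : R) : dual S := (g r, g (d r)).
Fact dual_map_additive : zmod_morphism dual_map.
Proof.
move=> x y; have dB : d (x - y) = (d x : R) - d y by apply: (linearB d).
by rewrite /dual_map dB !rmorphB.
Qed.
Fact dual_map_mult : monoid_morphism dual_map.
Proof.
split=> [|x y]; rewrite /dual_map; last first.
  rewrite calg_derM rmorphM rmorphD !rmorphM; congr (_, _).
  by rewrite addrC.
rewrite rmorph1; congr (_, _).
by rewrite calg_der1 rmorph0.
Qed.
HB.instance Definition _ :=
  GRing.isZmodMorphism.Build R (dual S) dual_map dual_map_additive.
HB.instance Definition _ :=
  GRing.isMonoidMorphism.Build R (dual S) dual_map dual_map_mult.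

Definition dual_calg : calg R := @CAlg R (dual S) dual_map.
Definition dual_proj : chom dual_calg (calg_over g) :=
  @CHom R dual_calg (calg_over g) (@dual_fst S) (fun=> erefl).

Fact dual_proj_surj : surjective dual_proj.
Proof. by move=> s; exists (s, 0). Qed.
Fact dual_proj_sq (x y : dual_calg) :
  dual_proj x = 0 -> dual_proj y = 0 -> x * y = 0.
Proof.
case: x y => [a b] [c e] /= a0 c0; rewrite /dual_fst /= in a0 c0.
by rewrite a0 c0 /GRing.mul /= /dual_mul /= !mul0r mulr0 addr0.
Qed.

Fact id_chomE a : (idfun : {rmorphism S -> S}) (cmap (calg_over g) a) =
  cmap (calg_over g) a.
Proof. by []. Qed.
Definition id_chom : chom (calg_over g) (calg_over g) := @CHom R (calg_over g) (calg_over g) idfun id_chomE.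

Lemma der_ext_ex : exists d', extends g d d'.
Proof.
have [[h hE] _] := feS dual_proj_surj dual_proj_sq id_chom.
have h1 s : (h s).1 = s := hE s.
pose e (s : S) : S := (h s).2.
have hg (r : R) : h (g r) = dual_map r := chomE h r.
have eD x y : e (x + y) = e x + e y by rewrite /e rmorphD.
have eM x y : e (x * y) = e x * y + x * e y.
  by rewrite /e rmorphM /= !h1 addrC.
have eg r : e (g r) = g (d r) by rewrite /e hg.
have e_der : @is_der k (calg_alg S) e.
  suff eL a x y : e (cmap S a * x + y) = cmap S a * e x + e y by split.
  rewrite eD eM -{1}(chomE g) eg.
  suff -> : d (cmap R a) = 0 :> R by rewrite rmorph0 mul0r add0r.
  by rewrite -[cmap R a]mulr1 calg_derZ calg_der1 mulr0.
by exists (Der (is_der_pred e_der)).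
Qed.

Lemma der_ext_unique d1 d2 : extends g d d1 -> extends g d d2 -> d1 = d2.
Proof.
have H (d' : der (calg_alg S)) : extends g d d' ->
    exists h : chom (calg_over g) dual_calg, forall s, h s = (s, d' s : S).
  move=> dE.
  pose f (s : S) : dual S := (s, d' s).
  have fB : zmod_morphism f.
    move=> x y; have dB : d' (x - y) = (d' x : S) - d' y by apply: (linearB d').
    by rewrite /f dB.
  have fM : monoid_morphism f.
    split=> [|x y]; rewrite /f; last by rewrite calg_derM addrC.
    by rewrite calg_der1.
  pose fB' := GRing.isZmodMorphism.Build S (dual S) f fB.
  pose fM' := GRing.isMonoidMorphism.Build S (dual S) f fM.
  pose F : {rmorphism S -> dual S} := HB.pack f fB' fM'.
  have FE r : F (cmap (calg_over g) r) = cmap dual_calg r.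
    by rewrite /= /f /dual_map dE.
  by exists (@CHom R (calg_over g) dual_calg F FE).
move=> /H [h1 h1E] /H [h2 h2E]; apply: der_inj => s.
have [_ U] := feS dual_proj_surj dual_proj_sq id_chom.
have : h1 s = h2 s by apply: U => t; rewrite /= (h1E, h2E).
by rewrite h1E h2E => -[].
Qed.

Lemma der_extP : extends g d (der_ext g d).
Proof. exact: (xgetPex 0 der_ext_ex). Qed.

End OneDerivation.

End DerivationExtensionTheory.

(* The subalgebra of S annihilated by the extensions of all derivations of R. *)
Section Constants.
Variables (k : comPzRingType) (R S : calg k) (g : chom R S).

Definition const_pred : pred S :=
  fun s => `[< forall d : der (calg_alg R), der_ext g d s = 0 >].

Fact const_subring_closed : subring_closed const_pred.
Proof.
split=> [|x y /asboolP hx /asboolP hy|x y /asboolP hx /asboolP hy];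
  apply/asboolP => d.
- exact: calg_der1.
- have -> : der_ext g d (x - y) = der_ext g d x - der_ext g d y.
    exact: (linearB (der_ext g d)).
  by rewrite hx hy subr0.
- have E : (0 : S) * y + x * 0 = 0 by rewrite mul0r mulr0 addr0.
  by rewrite [LHS]calg_derM hx hy; exact: E.
Qed.

Record const_ring : Type := Const { const_val :> S; _ : const_pred const_val }.
HB.instance Definition _ := [isSub for const_val].
HB.instance Definition _ := [Choice of const_ring by <:].
HB.instance Definition _ := GRing.SubChoice_isSubComPzRing.Build
  S const_pred const_ring const_subring_closed.

Fact const_cmap_subproof (a : k) : const_pred (cmap S a).
Proof.
apply/asboolP => d; rewrite -[cmap S a]mulr1 [LHS]calg_derZ calg_der1.
exact: mulr0.
Qed.

Definition const_cmap (a : k) : const_ring := Const (const_cmap_subproof a).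
Fact const_cmap_additive : zmod_morphism const_cmap.
Proof. by move=> a b; apply: val_inj; rewrite /= rmorphB. Qed.
Fact const_cmap_mult : monoid_morphism const_cmap.
Proof.
split=> [|a b]; apply: val_inj; rewrite /=; first exact: rmorph1.
exact: rmorphM.
Qed.
HB.instance Definition _ :=
  GRing.isZmodMorphism.Build k const_ring const_cmap const_cmap_additive.
HB.instance Definition _ :=
  GRing.isMonoidMorphism.Build k const_ring const_cmap const_cmap_mult.

Definition const : calg k := @CAlg k const_ring const_cmap.

Definition const_incl : chom const S :=
  @CHom k const S (val : {rmorphism const_ring -> S}) (fun=> erefl).

End Constants.

Section Descent.
Variables (k : comPzRingType) (R R' : calg k) (g : chom R R').

Let R1 : calg R := calg_over g.
Let R2 : calg R := ctens R1 R1.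
Let R3 : calg R := ctens R2 R1.

(* R'' and R''' as k-algebras                                                 *)
Definition desc2 : calg k := res_calg R2.
Definition desc3 : calg k := res_calg R3.

Definition desc_struct : chom R desc2 :=
  @CHom k R desc2 (cmap R2) (fun=> erefl).

Fact desc_p1E a : inl_chom R1 R1 (cmap R' a) = cmap desc2 a.
Proof. by rewrite -(chomE g). Qed.
Definition desc_p1 : chom R' desc2 := @CHom k R' desc2 (inl_chom R1 R1) desc_p1E.

Fact desc_p2E a : inr_chom R1 R1 (cmap R' a) = cmap desc2 a.
Proof. by rewrite -(chomE g) -[LHS]/(inr_chom R1 R1 (cmap R1 (cmap R a))) chomE. Qed.
Definition desc_p2 : chom R' desc2 := @CHom k R' desc2 (inr_chom R1 R1) desc_p2E.

(* a (x) b |-> a (x) b (x) 1,  a (x) 1 (x) b,  1 (x) a (x) b                  *)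
Definition desc_p12 : chom desc2 desc3 := res_chom (inl_chom R2 R1).
Definition desc_p13 : chom desc2 desc3 :=
  res_chom (copair (chom_comp (inl_chom R1 R1) (inl_chom R2 R1))
                   (inr_chom R2 R1)).
Definition desc_p23 : chom desc2 desc3 :=
  res_chom (copair (chom_comp (inr_chom R1 R1) (inl_chom R2 R1))
                   (inr_chom R2 R1)).

Variable A : alg k.

Definition cocycle (u : aut (bc A desc2)) : Prop :=
  aut_map desc_p13 u =1 aut_map desc_p23 u \o aut_map desc_p12 u.

Section Twist.
Variable u : aut (bc A desc2).

Definition twist_pred : pred (@res_alg R R1 (bc A R')) :=
  fun x => u (bcmap desc_p1 x) == bcmap desc_p2 x.

Fact twist_submod_closed : submod_closed twist_pred.
Proof.
split=> [|a x y /eqP hx /eqP hy].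
  apply/eqP; rewrite [bcmap desc_p1 _]bcmap0 linear0; exact: esym (bcmap0 _ _).
apply/eqP.
have E (p : chom R' desc2) : (forall r, p (g r) = desc_struct r) ->
    bcmap p (a *: x + y) = desc_struct a *: bcmap p x + bcmap p y.
  by move=> pE; rewrite -pE -bcmapZ -bcmapD.
rewrite !E ?linearP ?hx ?hy // => r.
exact: (chomE (inr_chom R1 R1)).
Qed.

HB.instance Definition _ := GRing.isSubmodClosed.Build R
  (@res_alg R R1 (bc A R')) twist_pred twist_submod_closed.

Record twist_mod : Type :=
  Twist { twist_val :> @res_alg R R1 (bc A R'); _ : twist_pred twist_val }.
HB.instance Definition _ := [isSub for twist_val].
HB.instance Definition _ := [Choice of twist_mod by <:].
HB.instance Definition _ := [SubChoice_isSubLmodule of twist_mod by <:].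

Lemma twist_valP (x : twist_mod) :
  u (bcmap desc_p1 (twist_val x)) = bcmap desc_p2 (twist_val x).
Proof. by case: x => x /= /eqP. Qed.

Fact twist_mul_subproof (x y : twist_mod) :
  twist_pred (amul (twist_val x) (twist_val y)).
Proof.
apply/eqP; rewrite [bcmap _ _]bcmapM [RHS]bcmapM autM.
by congr amul; apply: twist_valP.
Qed.
Definition twist_mul (x y : twist_mod) : twist_mod :=
  Twist (twist_mul_subproof x y).

Fact twist_mul_bilin : @bilin R twist_mod twist_mod twist_mod twist_mul.
Proof.
split=> [x a y y'|y a x x']; apply: val_inj.
  exact: (amul_bilin (@res_alg R R1 (bc A R'))).1.
exact: (amul_bilin (@res_alg R R1 (bc A R'))).2.
Qed.

(* the twisted form L_u                                                       *)
Definition twist : alg R := Alg twist_mul_bilin.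

End Twist.

End Descent.

(* id_A (x) d                                                                 *)
Definition id_tens (k : comPzRingType) (A : alg k) (S : calg k)
    (d : der (calg_alg S)) : bc A S -> bc A S :=
  tmap (idfun : {linear A -> A}) (d : {linear calg_alg S -> calg_alg S}).

Lemma id_tensE (k : comPzRingType) (A : alg k) (S : calg k)
  (d : der (calg_alg S)) (x : A) (s : S) :
  id_tens d (bcpure x s) = bcpure x (d s : S).
Proof. exact: tmapE. Qed.

(* Main.v *)
From HB Require Import structures.
Require Import Defs.
From mathcomp Require Import all_boot all_algebra.
From mathcomp Require Import boolp classical_sets functions.

Set Implicit Arguments.
Unset Strict Implicit.
Unset Printing Implicit Defensive.

Import GRing.Theory.
Local Open Scope ring_scope.
Local Open Scope classical_set_scope.

(** Write d' and d'' for the extensions of a derivation d of R to R' and to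
    R'' = R' (x)_R R'.  An extension along an etale map is unique, because a
    derivation vanishing on the base is zero ([formally_etale_der0]).
    This uniqueness has two consequences.  The map d |-> d' is linear and
    respects brackets, and each coprojection p_i : R' -> R'' satisfies
    p_i o d' = d'' o p_i ([der_ext_nat]), since both sides are derivations
    along p_i that agree on R.

    Now let u come from an automorphism u0 over the ring R''_0 of elements
    killed by all the d''.  On A (x) R'' the map id (x) d'' commutes with u: it
    kills u (a (x) 1), which has its coefficients in R''_0, so on u (a (x) t)
    = t u (a (x) 1) it only differentiates t ([id_tens_aut_map]).  Hence, for x in L_u,
      u (p_1 (d' x)) = u (d'' (p_1 x)) = d'' (u (p_1 x)) = d'' (p_2 x)
                     = p_2 (d' x),
    that is, id (x) d' stabilizes L_u ([id_tens_der_ext_twist]).  By the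
    Leibniz rule the commutator of id (x) d' with the homothety by r in R is
    the homothety by d' r = d r, so rho : d |-> id (x) d' is a section of eta.

    The rest holds for every R-algebra L whose centroid is R: the kernel of
    the Lie homomorphism eta is Der_R(L) ([range_der_res]), so that a Lie
    section of eta splits Der_k(L) ([semidirect_eta_section]).  If R is etale
    over k, then Der_k(R) = 0, and all of Der_k(L) is the kernel of eta. *)

(** * Derivations out of an etale algebra *)

(** The homomorphisms s |-> h s + D s eps and s |-> h s from S to the dual
    numbers T[eps] lift the same map to T = T[eps]/(eps), and the kernel (eps)
    has square zero; formal etaleness makes them equal.  The ring T needs no
    algebra structure, as it acquires one through h. *)
Lemma formally_etale_der0 (R : comPzRingType) (S : calg R) (T : comPzRingType)
    (h : {rmorphism S -> T}) (D : S -> T) :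
  formally_etale S ->
  {morph D : x y / x + y} ->
  (forall x y, D (x * y) = D x * h y + h x * D y) ->
  (forall a, D (cmap S a) = 0) ->
  forall s, D s = 0.
Proof.
move=> feS DD DM D0.
pose T0 : calg R := CAlg (h \o cmap S).
pose R0 : calg R := @CAlg R R idfun.
(* R is viewed as an algebra over itself: its zero derivation then gives the
   dual numbers the R-algebra structure a |-> (h a, 0). *)
have g0E a : (cmap T0 : {rmorphism R -> T}) (cmap R0 a) = cmap T0 a by [].
pose g0 : chom R0 T0 := @CHom R R0 T0 (cmap T0) g0E.
pose d0 : der (calg_alg R0) := 0.
have mk (E : S -> T) : {morph E : x y / x + y} ->
    (forall x y, E (x * y) = E x * h y + h x * E y) ->
    (forall a, E (cmap S a) = 0) ->
    exists f : chom S (dual_calg g0 d0), forall s, f s = (h s, E s).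
  move=> ED EM E0.
  pose f (s : S) : dual T := (h s, E s).
  have fB : zmod_morphism f.
    move=> x y; rewrite /f rmorphB; congr (_, _).
    by apply: (addIr (E y)); rewrite -ED !subrK.
  have fM : monoid_morphism f.
    split=> [|x y]; rewrite /f; last by rewrite rmorphM EM addrC.
    by rewrite rmorph1 -(rmorph1 (cmap S)) E0.
  pose fB' := GRing.isZmodMorphism.Build S (dual T) f fB.
  pose fM' := GRing.isMonoidMorphism.Build S (dual T) f fM.
  pose F : {rmorphism S -> dual T} := HB.pack f fB' fM'.
  have FE a : F (cmap S a) = cmap (dual_calg g0 d0) a.
    rewrite /= /f /dual_map E0; congr (_, _); exact: esym (rmorph0 g0).
  by exists (@CHom R S (dual_calg g0 d0) F FE).
have [f fE] := mk D DD DM D0.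
have [||a|f0 f0E] := mk (fun=> 0).
- by move=> x y; rewrite addr0.
- by move=> x y; rewrite mul0r mulr0 addr0.
- by [].
have jE a : h (cmap S a) = cmap (calg_over g0) a by [].
pose j : chom S (calg_over g0) := @CHom R S (calg_over g0) h jE.
have [_ U] := feS _ _ (dual_proj g0 d0) (@dual_proj_surj _ _ _ g0 d0)
  (@dual_proj_sq _ _ _ g0 d0) j.
move=> s; have : f s = f0 s by apply: U => t; rewrite /= (fE, f0E).
by rewrite fE f0E => -[].
Qed.

Section CalgDer.
Variables (k : comPzRingType) (S : calg k).

Lemma calg_der_cmap (d : der (calg_alg S)) a : d (cmap S a) = 0 :> S.
Proof. by rewrite -[cmap S a]mulr1 [LHS]calg_derZ calg_der1 mulr0. Qed.

Lemma formally_etale_der_eq0 (d : der (calg_alg S)) : formally_etale S -> d = 0.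
Proof.
move=> feS; apply: der_inj => s.
apply: (@formally_etale_der0 _ S S idfun (d : S -> S)) => //.
- exact: calg_derD.
- exact: calg_derM.
- exact: calg_der_cmap.
Qed.

End CalgDer.

(** * Extension of derivations along an etale map *)

Section ExtensionLie.
Variables (k : comPzRingType) (R S : calg k) (g : chom R S).
Hypothesis feS : formally_etale (calg_over g).

Lemma der_ext_linear : linear (@der_ext k R S g).
Proof.
move=> a d e; apply: (der_ext_unique feS (der_extP feS _)) => r.
change (cmap S a * (der_ext g d (g r) : S) + der_ext g e (g r) =
  g (cmap R a * d r + e r)).
by rewrite !(der_extP feS) rmorphD rmorphM chomE.
Qed.

Lemma der_ext_br d e :
  der_ext g (der_br d e) = der_br (der_ext g d) (der_ext g e).
Proof.
apply: (der_ext_unique feS (der_extP feS _)) => r.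
change ((der_ext g d (der_ext g e (g r)) : S) - der_ext g e (der_ext g d (g r))
  = g ((d (e r) : R) - e (d r))).
by rewrite !(der_extP feS) rmorphB.
Qed.

(** The difference of the two sides is a derivation along p vanishing on R.
    This applies to both coprojections R' -> R'', which are different maps
    with the same restriction to R. *)
Lemma der_ext_nat (T : calg k) (h : chom R T) (p : chom S T) d s :
  formally_etale (calg_over h) -> (forall r, p (g r) = h r) ->
  p (der_ext g d s) = der_ext h d (p s).
Proof.
move=> feT pE; apply/eqP; rewrite -subr_eq0; apply/eqP; move: s.
apply: (@formally_etale_der0 R (calg_over g) T p
  (fun s : S => p (der_ext g d s) - der_ext h d (p s) : T)) => //.
- by move=> x y; rewrite calg_derD !rmorphD calg_derD opprD addrACA.
- move=> x y; rewrite calg_derM !rmorphM calg_derM rmorphD !rmorphM.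
  by rewrite opprD addrACA mulrBl mulrBr.
- move=> r; rewrite [cmap _ _]/(g r) (der_extP feS) !pE (der_extP feT).
  exact: subrr.
Qed.

End ExtensionLie.

(** * The operators id (x) d on a base change *)

Section IdTens.
Variables (k : comPzRingType) (A : alg k) (S : calg k) (d : der (calg_alg S)).
Implicit Types q r : bc A S.

Lemma id_tensD q r : id_tens d (q + r) = id_tens d q + id_tens d r.
Proof. exact: tmapD. Qed.
Lemma id_tens0 : id_tens d (0 : bc A S) = 0.
Proof. exact: tmap0. Qed.

Lemma id_tensZ (s : S) q :
  id_tens d (s *: q) = (d s : S) *: q + s *: id_tens d q.
Proof.
elim/bc_ind: q => [x t|q r h h'|].
- rewrite bcpureZ !id_tensE !bcpureZ calg_derM; exact: tpureDr.
- by rewrite scalerDr !id_tensD h h' !scalerDr addrACA.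
- by rewrite scaler0 id_tens0 !scaler0 addr0.
Qed.

Lemma id_tensM q r :
  id_tens d (amul q r) = amul (id_tens d q) r + amul q (id_tens d r).
Proof.
elim/bc_ind: q => [x s|q q' h h'|].
- elim/bc_ind: r => [y t|r r' h h'|].
  + rewrite /= bc_mulE !id_tensE !bc_mulE calg_derM; exact: tpureDr.
  + by rewrite !(amulDr, id_tensD) h h' addrACA.
  + by rewrite !(amul0r, id_tens0) addr0.
- by rewrite !(amulDl, id_tensD) h h' addrACA.
- by rewrite !(amul0l, id_tens0) addr0.
Qed.

End IdTens.

Lemma id_tens_der_linear (k : comPzRingType) (A : alg k) (S : calg k) a
    (d e : der (calg_alg S)) (q : bc A S) :
  id_tens (a *: d + e) q = cmap S a *: id_tens d q + id_tens e q.
Proof.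
elim/bc_ind: q => [x t|q r h h'|].
- rewrite !id_tensE bcpureZ; exact: tpureDr.
- by rewrite !id_tensD h h' scalerDr addrACA.
- by rewrite !id_tens0 scaler0 addr0.
Qed.

Lemma id_tens_br (k : comPzRingType) (A : alg k) (S : calg k)
    (d e : der (calg_alg S)) (q : bc A S) :
  id_tens (der_br d e) q = id_tens d (id_tens e q) - id_tens e (id_tens d q).
Proof.
elim/bc_ind: q => [x t|q r h h'|].
- rewrite !id_tensE; apply: (addIr (bcpure x (e (d t) : S))).
  rewrite subrK; apply: etrans (esym (tpureDr _ _ _)) _.
  by congr (tpure x _); apply: subrK.
- by rewrite !id_tensD h h' opprD addrACA.
- by rewrite !id_tens0 subr0.
Qed.

Lemma id_tens_bcmap (k : comPzRingType) (A : alg k) (S T : calg k)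
    (p : chom S T) (d : der (calg_alg S)) (e : der (calg_alg T)) (q : bc A S) :
  (forall s, p (d s) = e (p s)) ->
  bcmap p (id_tens d q) = id_tens e (bcmap p q).
Proof.
move=> pde; elim/bc_ind: q => [x t|q r h h'|].
- by rewrite id_tensE !bcmapE id_tensE pde.
- by rewrite !(id_tensD, bcmapD) h h'.
- by rewrite !(id_tens0, bcmap0).
Qed.

(** The base change of u is determined by its values on the vectors a (x) 1.
    These values come from A (x) S, where id (x) e vanishes; so on both sides e
    only differentiates the scalar t of a (x) t. *)
Lemma id_tens_aut_map (k : comPzRingType) (A : alg k) (S T : calg k)
    (p : chom S T) (u : aut (bc A S)) (e : der (calg_alg T)) (q : bc A T) :
  (forall s, e (p s) = 0 :> T) ->
  id_tens e (aut_map p u q) = aut_map p u (id_tens e q).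
Proof.
move=> ep0; have kill (q0 : bc A S) : id_tens e (bcmap p q0) = 0.
  rewrite -(@id_tens_bcmap k A S T p 0 e q0); last by move=> s; rewrite ep0 rmorph0.
  elim/bc_ind: q0 => [x t|q1 r h h'|].
  - rewrite id_tensE bcmapE rmorph0; exact: (bilin0r (@tpure_bilin k A (cmod T))).
  - by rewrite id_tensD bcmapD h h' addr0.
  - by rewrite id_tens0 bcmap0.
elim/bc_ind: q => [x t|q r h h'|].
- by rewrite id_tensE /= !bc_ext_pure id_tensZ kill scaler0 addr0.
- by rewrite !(id_tensD, linearD) h h'.
- by rewrite !(id_tens0, linear0).
Qed.

(** * The kernel of eta, and Lie sections of eta *)

Section EtaKernel.
Variables (k : comPzRingType) (R : calg k) (L : alg R).
Hypothesis chiL : @chi_iso k R L.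

(** By definition of eta, d (r x) = eta d r x + r d x; so d is R-linear as
    soon as eta d = 0, and conversely because R acts faithfully on L. *)
Lemma range_der_res (d : der (res_alg L)) :
  range (@der_res k R L) d <-> eta d = 0.
Proof.
have E (r : R) (x : L) : d (r *: x) = eta d r *: x + r *: (d x : L) :> L.
  have := congr1 (fun f : L -> L => f x) (etaP chiL d r).
  by rewrite /commutator /chi => <-; rewrite subrK.
split=> [[d0 _ <-]|d0].
  apply: (eta_unique chiL) => r; apply/funext => x.
  by rewrite /commutator /chi /= derZ subrr scale0r.
have dR : @is_der R L d.
  split=> [a x y|x y]; last exact: (derM d).
  have dD : d (a *: (x : L) + y) = d (a *: (x : L)) + (d y : L) :> L.
    exact: (linearD d).
  by rewrite dD E d0 scale0r add0r.
by exists (Der (is_der_pred dR)) => //; apply: der_inj.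
Qed.

(** The decomposition of x is x = (x - rho (eta x)) + rho (eta x). *)
Lemma semidirect_eta_section
    (rho : {linear der (calg_alg R) -> der (res_alg L)}) :
  (forall d e, rho (der_br d e) = der_br (rho d) (rho e)) ->
  cancel rho (@eta k R L) ->
  semidirect (range (@der_res k R L)) (range rho).
Proof.
move=> rhoB rhoK; have eta0 : eta (0 : der (res_alg L)) = 0.
  by rewrite -[RHS]rhoK linear0.
split.
- split; first split; first exact/range_der_res.
    move=> a x y /range_der_res hx /range_der_res hy; apply/range_der_res.
    by rewrite (eta_linear chiL) hx hy scaler0 addr0.
  move=> x y /range_der_res hy; apply/range_der_res.
  rewrite (eta_br chiL) hy; apply: der_inj => r.
  rewrite -[RHS]/(0 : R) -[LHS]/((eta x 0 : R) - 0).
  by rewrite subr0 (linear0 (eta x)).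
- split; first split; first by exists 0; rewrite ?linear0.
    by move=> a _ _ [d _ <-] [e _ <-]; exists (a *: d + e); rewrite ?linearP.
  by move=> _ _ [d _ <-] [e _ <-]; exists (der_br d e).
- by move=> x /range_der_res hx [d _ dx]; rewrite -dx -(rhoK d) dx hx linear0.
- move=> x; exists (x - rho (eta x)), (rho (eta x)); split.
  + apply/range_der_res.
    rewrite addrC -scaleN1r (eta_linear chiL) rhoK scaleN1r; exact: addNr.
  + by exists (eta x).
  + by rewrite subrK.
Qed.

End EtaKernel.

(** * The section of eta on a twisted form *)

Section TwistDerivation.
Variables (k : comPzRingType) (A : alg k) (R R' : calg k) (g : chom R R').
Variable u : aut (bc A (desc2 g)).
Hypothesis feg : formally_etale (calg_over g).
Hypothesis u_const : exists u0 : aut (bc A (const (desc_struct g))),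
  aut_map (const_incl (desc_struct g)) u0 =1 u.

Lemma formally_etale_desc_struct : formally_etale (calg_over (desc_struct g)).
Proof. exact: formally_etale_ctens. Qed.

(** The equation u (p_1 x) = p_2 x can be differentiated by d'': the latter
    restricts to d' along p_1 and p_2, and commutes with u because u is defined
    over the ring of constants. *)
Lemma id_tens_der_ext_twist (d : der (calg_alg R)) (x : twist u) :
  twist_pred u (id_tens (der_ext g d) (twist_val x)).
Proof.
have [u0 u0E] := u_const; have fe2 := formally_etale_desc_struct.
have pd (p : chom R' (desc2 g)) : (forall r, p (g r) = desc_struct g r) ->
    bcmap p (id_tens (der_ext g d) (twist_val x)) =
    id_tens (der_ext (desc_struct g) d) (bcmap p (twist_val x)).
  by move=> pE; apply: id_tens_bcmap => s; apply: der_ext_nat.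
apply/eqP; rewrite !pd //; last exact: (chomE (inr_chom _ _)).
rewrite -twist_valP -!u0E id_tens_aut_map // => -[s s_const].
have /asboolP ds := s_const; exact: ds.
Qed.

Definition twist_der_fun (d : der (calg_alg R)) (x : twist u) : twist u :=
  Twist (id_tens_der_ext_twist d x).

(** This identity gives both the k-linearity of the operator, since d vanishes
    on the image of k, and the value d of eta on it. *)
Lemma twist_der_funZ d r (x : twist u) :
  twist_der_fun d (r *: x) = d r *: x + r *: twist_der_fun d x.
Proof.
apply: val_inj; apply: etrans (id_tensZ _ _ _) _.
by rewrite (der_extP feg).
Qed.

Lemma twist_der_funD d (x y : twist u) :
  twist_der_fun d (x + y) = twist_der_fun d x + twist_der_fun d y.
Proof. by apply: val_inj; apply: id_tensD. Qed.

Fact twist_der_subproof d :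
  @der_pred k (res_alg (twist u)) (twist_der_fun d).
Proof.
apply: is_der_pred; split=> [a x y|x y]; last by apply: val_inj; apply: id_tensM.
rewrite -[RHS]/(cmap R a *: twist_der_fun d x + twist_der_fun d y).
rewrite -[LHS]/(twist_der_fun d (cmap R a *: (x : twist u) + y)).
rewrite twist_der_funD twist_der_funZ.
by rewrite (calg_der_cmap d a) scale0r add0r.
Qed.

Definition twist_der d : der (res_alg (twist u)) := Der (twist_der_subproof d).

Fact twist_der_linear : linear twist_der.
Proof.
move=> a d e; apply: der_inj => x; apply: val_inj.
apply: etrans; first exact: (congr1 (fun f => id_tens f _) (der_ext_linear feg a d e)).
by rewrite id_tens_der_linear -(chomE g).
Qed.
HB.instance Definition _ := GRing.isLinear.Build k (der (calg_alg R))
  (der (res_alg (twist u))) *:%R twist_der twist_der_linear.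

Lemma twist_der_br d e :
  twist_der (der_br d e) = der_br (twist_der d) (twist_der e).
Proof.
apply: der_inj => x; apply: val_inj.
apply: etrans; first exact: (congr1 (fun f => id_tens f _) (der_ext_br feg d e)).
exact: id_tens_br.
Qed.

Lemma twist_derK : @chi_iso k R (twist u) ->
  cancel twist_der (@eta k R (twist u)).
Proof.
move=> chiL d; apply: (eta_unique chiL) => r; apply/funext => x.
by rewrite /commutator /chi /= twist_der_funZ addrK.
Qed.

End TwistDerivation.

Theorem theorem4p2 (k : comPzRingType) (A : alg k) (R R' : calg k)
  (g : chom R R') (u : aut (bc A (desc2 g))) :
  fin_pres_mod A ->
  faithfully_flat (calg_over g) ->
  etale (calg_over g) ->
  flat R ->
  cocycle u ->
  chi_iso (twist u) ->
  (exists u0 : aut (bc A (const (desc_struct g))),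
     aut_map (const_incl (desc_struct g)) u0 =1 u) ->
  (exists rho : {linear der (calg_alg R) -> der (res_alg (twist u))},
     [/\ forall d e, rho (der_br d e) = der_br (rho d) (rho e),
         forall d x, twist_val (rho d x) = id_tens (der_ext g d) (twist_val x),
         cancel rho (@eta k R (twist u))
       & semidirect (range (@der_res k R (twist u))) (range rho)]) /\
  (etale R -> range (@der_res k R (twist u)) = setT).
Proof.
move=> _ _ [feg _] _ _ chiL u_const; split.
  exists (twist_der feg u_const); split=> //; first exact: twist_der_br.
    exact: twist_derK.
  by apply: semidirect_eta_section => //; [apply: twist_der_br|apply: twist_derK].
move=> [feR _]; apply/seteqP; split=> // d _; apply/(range_der_res chiL).
exact: formally_etale_der_eq0.
Qed.
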